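(* For every extended regular nondeterministic nominal automaton (ERNNA) $A$ there exists a bar formula $\phi$ such that $[\![\phi]\!]=L_\alpha(A)$.
   Context: Names $\mathbb{A}$ (countably infinite), the group $G$ of finite permutations of $\mathbb{A}$, nominal sets (sets with $G$-action where each element has a finite support; $\mathrm{supp}(x)$ least support), orbits, orbit-finiteness, equivariance as usual. Abstraction set $[\mathbb{A}]X$: $\mathbb{A}\times X$ modulo $(a,x)\sim(b,y)$ iff $(a\,c)\cdot x=(b\,c)\cdot y$ for some $c$ outside the supports of $a,x,b,y$; class written $\langle a\rangle x$. $\overline{\mathbb{A}}=\mathbb{A}\cup\{|a\mid a\in\mathbb{A}\}$, bar strings are words over $\overline{\mathbb{A}}$ with letterwise action; $\equiv_\alpha$ is the least equivalence with $w|av\equiv_\alpha w|bu$ whenever $\langle a\rangle v=\langle b\rangle u$ in $[\mathbb{A}]\overline{\mathbb{A}}^*$. Free occurrence of plain $a$: no $|a$ to its left; $\mathrm{FN}(w)$; $[S]=\{w\mid\mathrm{FN}(w)\subseteq S\}$. Bar formulae: $\phi::=\epsilon\mid\neg\epsilon\mid\phi\wedge\phi\mid\phi\vee\phi\mid\Diamond_\sigma\phi\mid\Box_\sigma\phi\mid X\mid\mu X.\phi$ ($\sigma\in\overline{\mathbb{A}}$), with all free occurrences of $X$ in $\phi$ in the scope of a modality in $\mu X.\phi$; $\top=\epsilon\vee\neg\epsilon$. Free names $\mathrm{FN}(\phi)$: names $a$ with some $\Diamond_a/\Box_a$ outside the scope of all $\Diamond_{|a}/\Box_{|a}$. Fixpoint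 variables implicitly annotated with the free names of their binding $\mu$-expression. Semantics $S,w\models\phi$ for finite $S\supseteq\mathrm{FN}(\phi)$, $w\in[S]$: Booleans usual; $\epsilon$ iff $w$ empty; $\neg\epsilon$ iff nonempty; $\mu X.\phi$ iff $S,w\models\phi[\mu X.\phi/X]$; $\Diamond_a\phi$ iff $w=av$, $S,v\models\phi$; $\Box_a\phi$ iff ($w=av\Rightarrow S,v\models\phi$); $\Diamond_{|a}\phi$ iff exist $\psi,v,b$ with $w\equiv_\alpha|bv$, $\langle a\rangle\phi=\langle b\rangle\psi$, $S\cup\{b\},v\models\psi$; $\Box_{|a}\phi$ iff for all $\psi,v,b$ with $w\equiv_\alpha|bv$ and $\langle a\rangle\phi=\langle b\rangle\psi$, $S\cup\{b\},v\models\psi$. $[\![\phi]\!]=\{w\in[\emptyset]\mid\emptyset,w\models\phi\}/{\equiv_\alpha}$. ERNNA $A=(Q,\to,s,f)$: $Q$ orbit-finite nominal set; $s\in Q$ with $\mathrm{supp}(s)=\emptyset$; equivariant $\to\subseteq Q\times(\overline{\mathbb{A}}\cup\{\epsilon\})\times Q$; equivariant $f:Q\to\{0,1,\top\}$; $q\xrightarrow{|a}q'$ and $\langle a\rangle q'=\langle b\rangle q''$ imply $q\xrightarrow{|b}q''$; for each $q$ the sets $\{(a,q')\mid q\xrightarrow{a}q'\}$, $\{q'\mid q\xrightarrow{\epsilon}q'\}$, $\{\langle a\rangle q'\mid q\xrightarrow{|a}q'\}$ are finite; every $q$ with $f(q)=\top$ has empty support and no outgoing transitions. With $\to$ extended to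 words, $L_{pre}(A)=\{(w,f(q))\mid s\xrightarrow{w}q, f(q)\in\{1,\top\}\}$, $L_0(A)=[\emptyset]\cap(\{w\mid(w,1)\in L_{pre}(A)\}\cup\{vu\mid(v,\top)\in L_{pre}(A),u\in\overline{\mathbb{A}}^*\})$, $L_\alpha(A)=L_0(A)/{\equiv_\alpha}$. *)

(* Defs.v *)
From mathcomp Require Import all_boot.
From Stdlib Require List.

Set Implicit Arguments.
Unset Strict Implicit.
Unset Printing Implicit Defensive.

(* Names: the countably infinite set A is represented by nat.          *)

Definition finperm (p : nat -> nat) : Prop :=
  bijective p /\ exists s : seq nat, forall a, a \notin s -> p a = a.

Definition swap (a b : nat) (x : nat) : nat :=
  if x == a then b else if x == b then a else x.

Definition supports (X : Type) (act : (nat -> nat) -> X -> X)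
    (S : seq nat) (x : X) : Prop :=
  forall p, finperm p -> (forall a, a \in S -> p a = a) -> act p x = x.

Record nominal_set := NominalSet {
  nom_car :> Type;
  nom_act : (nat -> nat) -> nom_car -> nom_car;
  nom_act_id : forall x, nom_act id x = x;
  nom_act_comp : forall p q x, finperm p -> finperm q ->
      nom_act (p \o q) x = nom_act p (nom_act q x);
  nom_fin_supp : forall x, exists S : seq nat, supports nom_act S x
}.

(* a is fresh for x, i.e. a \notin supp(x) (the least support):
   equivalently some finite support of x avoids a. *)
Definition fresh (Q : nominal_set) (a : nat) (x : Q) : Prop :=
  exists S : seq nat, supports (@nom_act Q) S x /\ a \notin S.

Definition orbit_finite (Q : nominal_set) : Prop :=
  exists reps : list Q, forall q : Q,
    exists r, List.In r reps /\ exists p, finperm p /\ q = nom_act p r.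

(* equality <a>x = <b>y in the abstraction set [A]Q *)
Definition absQ (Q : nominal_set) (a : nat) (x : Q) (b : nat) (y : Q) : Prop :=
  exists c, c != a /\ c != b /\ fresh c x /\ fresh c y /\
    nom_act (swap a c) x = nom_act (swap b c) y.

Inductive bletter := Plain of nat | Bar of nat.

Definition bl_name (l : bletter) : nat := match l with Plain a => a | Bar a => a end.

Definition bl_act (p : nat -> nat) (l : bletter) : bletter :=
  match l with Plain a => Plain (p a) | Bar a => Bar (p a) end.

Definition bstring := seq bletter.

Definition bs_act (p : nat -> nat) (w : bstring) : bstring := map (bl_act p) w.

(* names occurring in a bar string (= its least support) *)
Definition bs_names (w : bstring) : seq nat := map bl_name w.

(* <a>v = <b>u in [A](Abar^* ) *)
Definition abs_bs (a : nat) (v : bstring) (b : nat) (u : bstring) : Prop :=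
  exists c, c != a /\ c != b /\ c \notin bs_names v /\ c \notin bs_names u /\
    bs_act (swap a c) v = bs_act (swap b c) u.

Inductive alpha : bstring -> bstring -> Prop :=
| alpha_step w a v b u : abs_bs a v b u ->
    alpha (w ++ Bar a :: v) (w ++ Bar b :: u)
| alpha_refl w : alpha w w
| alpha_sym w w' : alpha w w' -> alpha w' w
| alpha_trans w1 w2 w3 : alpha w1 w2 -> alpha w2 w3 -> alpha w1 w3.

Fixpoint bs_fn (w : bstring) : seq nat :=
  match w with
  | [::] => [::]
  | Plain a :: w' => a :: bs_fn w'
  | Bar a :: w' => filter (fun x => x != a) (bs_fn w')
  end.

Definition in_closure (S : seq nat) (w : bstring) : Prop :=
  {subset bs_fn w <= S}.

(* Saturation of a language under alpha-equivalence; two languages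
   have the same quotient L/==alpha iff their saturations coincide. *)
Definition alpha_sat (L : bstring -> Prop) (w : bstring) : Prop :=
  exists w', L w' /\ alpha w' w.

Definition same_quotient (L M : bstring -> Prop) : Prop :=
  forall w, alpha_sat L w <-> alpha_sat M w.

Inductive form :=
| FEps
| FNEps
| FAnd of form & form
| FOr of form & form
| FDia of bletter & form
| FBox of bletter & form
| FVar of nat & seq nat             (* fixpoint variable X, annotated with
                                       the free names of its binding mu *)
| FMu of nat & form.

Fixpoint f_act (p : nat -> nat) (phi : form) : form :=
  match phi with
  | FEps => FEps
  | FNEps => FNEps
  | FAnd f g => FAnd (f_act p f) (f_act p g)
  | FOr f g => FOr (f_act p f) (f_act p g)
  | FDia s f => FDia (bl_act p s) (f_act p f)
  | FBox s f => FBox (bl_act p s) (f_act p f)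
  | FVar X ann => FVar X (map p ann)
  | FMu X f => FMu X (f_act p f)
  end.

(* all names occurring in phi (its least support as syntax) *)
Fixpoint f_names (phi : form) : seq nat :=
  match phi with
  | FEps | FNEps => [::]
  | FAnd f g | FOr f g => f_names f ++ f_names g
  | FDia s f | FBox s f => bl_name s :: f_names f
  | FVar _ ann => ann
  | FMu _ f => f_names f
  end.

Fixpoint f_fn (phi : form) : seq nat :=
  match phi with
  | FEps | FNEps => [::]
  | FAnd f g | FOr f g => f_fn f ++ f_fn g
  | FDia (Plain a) f | FBox (Plain a) f => a :: f_fn f
  | FDia (Bar a) f | FBox (Bar a) f => filter (fun x => x != a) (f_fn f)
  | FVar _ _ => [::]
  | FMu _ f => f_fn f
  end.

(* <a>phi = <b>psi in [A]Form *)
Definition abs_form (a : nat) (phi : form) (b : nat) (psi : form) : Prop :=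
  exists c, c != a /\ c != b /\ c \notin f_names phi /\ c \notin f_names psi /\
    f_act (swap a c) phi = f_act (swap b c) psi.

Fixpoint f_subst (X : nat) (psi : form) (phi : form) : form :=
  match phi with
  | FEps => FEps
  | FNEps => FNEps
  | FAnd f g => FAnd (f_subst X psi f) (f_subst X psi g)
  | FOr f g => FOr (f_subst X psi f) (f_subst X psi g)
  | FDia s f => FDia s (f_subst X psi f)
  | FBox s f => FBox s (f_subst X psi f)
  | FVar Y ann => if Y == X then psi else FVar Y ann
  | FMu Y f => if Y == X then FMu Y f else FMu Y (f_subst X psi f)
  end.

Fixpoint guarded (X : nat) (phi : form) : bool :=
  match phi with
  | FEps | FNEps => true
  | FAnd f g | FOr f g => guarded X f && guarded X g
  | FDia _ _ | FBox _ _ => true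
  | FVar Y _ => Y != X
  | FMu Y f => (Y == X) || guarded X f
  end.

Fixpoint lookup (X : nat) (env : seq (nat * seq nat)) : option (seq nat) :=
  match env with
  | [::] => None
  | (Y, T) :: env' => if Y == X then Some T else lookup X env'
  end.

Definition same_set (S T : seq nat) : bool := all (mem T) S && all (mem S) T.

Fixpoint wf_form (env : seq (nat * seq nat)) (phi : form) : bool :=
  match phi with
  | FEps | FNEps => true
  | FAnd f g | FOr f g => wf_form env f && wf_form env g
  | FDia _ f | FBox _ f => wf_form env f
  | FVar X ann => if lookup X env is Some T then same_set ann T else false
  | FMu X f => guarded X f && wf_form ((X, f_fn (FMu X f)) :: env) f
  end.

Definition bar_formula (phi : form) : bool := wf_form [::] phi.

(* satisfaction S, w |= phi (least relation closed under the clauses;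
   by guardedness it is the unique one satisfying the defining
   equivalences) *)
Inductive sat : seq nat -> bstring -> form -> Prop :=
| sat_eps S : sat S [::] FEps
| sat_neps S l w : sat S (l :: w) FNEps
| sat_and S w f g : sat S w f -> sat S w g -> sat S w (FAnd f g)
| sat_orl S w f g : sat S w f -> sat S w (FOr f g)
| sat_orr S w f g : sat S w g -> sat S w (FOr f g)
| sat_mu S w X f : sat S w (f_subst X (FMu X f) f) -> sat S w (FMu X f)
| sat_dia S a v f : sat S v f -> sat S (Plain a :: v) (FDia (Plain a) f)
| sat_box S w a f :
    (forall v, w = Plain a :: v -> sat S v f) -> sat S w (FBox (Plain a) f)
| sat_diabar S w a f psi v b :
    alpha w (Bar b :: v) -> abs_form a f b psi -> sat (b :: S) v psi ->
    sat S w (FDia (Bar a) f)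
| sat_boxbar S w a f :
    (forall psi v b, alpha w (Bar b :: v) -> abs_form a f b psi ->
       sat (b :: S) v psi) ->
    sat S w (FBox (Bar a) f).

(* [[phi]] before quotienting: closed words satisfying phi with S = {} *)
Definition sem (phi : form) (w : bstring) : Prop :=
  in_closure [::] w /\ sat [::] w phi.

Inductive fval := F0 | F1 | FTop.

(* transitions: None = epsilon, Some l = letter l *)
Definition is_ernna (Q : nominal_set)
    (trans : Q -> option bletter -> Q -> Prop) (s : Q) (f : Q -> fval) : Prop :=
  orbit_finite Q /\
      supports (@nom_act Q) [::] s /\
      (forall p q o q', finperm p -> trans q o q' ->
         trans (nom_act p q) (omap (bl_act p) o) (nom_act p q')) /\
      (forall p q, finperm p -> f (nom_act p q) = f q) /\
      (forall q a q' b q'', trans q (Some (Bar a)) q' -> absQ a q' b q'' ->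
         trans q (Some (Bar b)) q'') /\
      (forall q,
         (exists l : list (nat * Q), forall a q',
            trans q (Some (Plain a)) q' -> List.In (a, q') l) /\
         (exists l : list Q, forall q', trans q None q' -> List.In q' l) /\
         (exists l : list (nat * Q), forall a q',
            trans q (Some (Bar a)) q' ->
            exists b r, List.In (b, r) l /\ absQ a q' b r)) /\
      (forall q, f q = FTop ->
         supports (@nom_act Q) [::] q /\ forall o q', ~ trans q o q').

Inductive run (Q : Type) (trans : Q -> option bletter -> Q -> Prop)
  : Q -> bstring -> Q -> Prop :=
| run_nil q : run trans q [::] q
| run_eps q q' w q'' : trans q None q' -> run trans q' w q'' -> run trans q w q''
| run_letter q l q' w q'' : trans q (Some l) q' -> run trans q' w q'' ->
    run trans q (l :: w) q''.

Definition L_pre (Q : Type) (trans : Q -> option bletter -> Q -> Prop)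
    (s : Q) (f : Q -> fval) (w : bstring) (v : fval) : Prop :=
  exists q, run trans s w q /\ f q = v /\ (v = F1 \/ v = FTop).

Definition L_0 (Q : Type) (trans : Q -> option bletter -> Q -> Prop)
    (s : Q) (f : Q -> fval) (w : bstring) : Prop :=
  in_closure [::] w /\
  (L_pre trans s f w F1 \/
   exists v u, w = v ++ u /\ L_pre trans s f v FTop).

(* Main.v *)
Require Import Defs.
From HB Require Import structures.
From mathcomp Require Import all_boot.
From mathcomp Require Import boolp.

(* Let k bound the sizes of the supports in Q and let N consist of k + 1 names.
   The states supported by N form a finite set, and since every state has a fresh
   name in N, each bar transition out of such a state can be renamed to one that
   stays inside this set: up to alpha-equivalence, a finite automaton over the
   letters a and |a with a in N suffices.  Its states unravel into nested fixpoint
   formulae whose variables are the states visited so far, and whose bodies are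
   disjunctions of diamonds, so that every variable is guarded.  A state never
   reads a plain name outside its support, hence the formula of s has no free name.
   Satisfaction of the formula is compared with runs by induction on the length of
   the word, simultaneously for all renamings of the finite automaton: a bar
   diamond renames the whole remaining formula, and a run of the renamed automaton
   can always pass through a name that is fresh for everything in sight. *)

Set Implicit Arguments.
Unset Strict Implicit.
Unset Printing Implicit Defensive.

(** * Names, bar strings and formulae *)

Lemma ex_fresh (s : seq nat) : exists c, c \notin s.
Proof.
exists (sumn s).+1; apply/negP.
have mem_le (x : nat) : x \in s -> x <= sumn s.
  elim: s => //= y s IHs; rewrite in_cons => /predU1P[->|/IHs]; first exact: leq_addr.
  by move/leq_trans; apply; apply: leq_addl.
by move/mem_le; rewrite ltnn.
Qed.

Lemma swapL a b : swap a b a = b.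
Proof. by rewrite /swap eqxx. Qed.

Lemma swapD a b x : x != a -> x != b -> swap a b x = x.
Proof. by rewrite /swap => /negPf-> /negPf->. Qed.

Lemma swapC a b : swap a b = swap b a.
Proof.
apply/funext => x; rewrite /swap; case: (eqVneq x a) => [->|//].
by case: (eqVneq a b).
Qed.

Lemma swapK a b : involutive (swap a b).
Proof.
move=> x; rewrite /swap; case: (eqVneq x a) => [->|xa].
  by rewrite eqxx; case: eqP.
by case: (eqVneq x b) => [->|xb]; rewrite ?eqxx // (negPf xa) (negPf xb).
Qed.

Lemma swap_inj a b : injective (swap a b).
Proof. exact: inv_inj (swapK a b). Qed.

Lemma swap_id a : swap a a = id.
Proof. by apply/funext => x; rewrite /swap; case: eqP. Qed.

Lemma swap_conj p a b : injective p -> swap (p a) (p b) \o p = p \o swap a b.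
Proof.
move=> p_inj; apply/funext => x.
by rewrite /swap /= !(inj_eq p_inj) !(fun_if p).
Qed.

(** Used to exchange the auxiliary fresh name [c] of an abstraction equality for another name
    [c']. *)
Lemma swap_via a c c' x : x != c -> x != c' -> swap a c' x = swap c c' (swap a c x).
Proof.
move=> xc xc'; have [->|xa] := eqVneq x a; first by rewrite !swapL.
by rewrite !swapD.
Qed.

(** Pointwise core of the renaming of a binder [a] to [b], shared by words, formulae and states. The
    last hypothesis lets [b] occur in the scope only when it is [a] itself. *)
Lemma swap_trans a b c x : c != a -> c != b -> x != c -> (x = b -> b = a) ->
  swap a c x = swap b c (swap b a x).
Proof.
move=> ca cb xc xb; have [->|xa] := eqVneq x a; first by rewrite swapL (swapC b a) !swapL.
by rewrite !swapD //; apply: contraNneq xa => e; rewrite e xb.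
Qed.

Lemma finperm_swap a b : finperm (swap a b).
Proof.
split; first exact: inv_bij (swapK a b).
by exists [:: a; b] => x; rewrite !inE negb_or => /andP[xa xb]; apply: swapD.
Qed.

Lemma finperm_id : finperm id.
Proof. by split; [exists id | exists [::]]. Qed.

Lemma finperm_comp p q : finperm p -> finperm q -> finperm (p \o q).
Proof.
move=> [p_bij [S pS]] [q_bij [T qT]]; split; first exact: bij_comp.
by exists (S ++ T) => a; rewrite mem_cat negb_or => /andP[aS aT] /=; rewrite qT // pS.
Qed.

Lemma finperm_inj p : finperm p -> injective p.
Proof. by move=> [/bij_inj]. Qed.

Lemma finperm_inv p : finperm p -> exists q, [/\ finperm q, cancel p q & cancel q p].
Proof.
move=> [[q pK qK] [S pS]]; exists q; split => //; split; first by exists p.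
by exists S => a /pS {1}<-.
Qed.

Definition bl_code (l : bletter) : bool * nat :=
  match l with Plain a => (false, a) | Bar a => (true, a) end.

Definition bl_decode (x : bool * nat) : bletter := if x.1 then Bar x.2 else Plain x.2.

Lemma bl_codeK : cancel bl_code bl_decode.
Proof. by case. Qed.

HB.instance Definition _ := Equality.copy bletter (can_type bl_codeK).

Lemma bl_act_comp p q l : bl_act (p \o q) l = bl_act p (bl_act q l).
Proof. by case: l. Qed.

Lemma bl_act_id l : bl_act id l = l.
Proof. by case: l. Qed.

Lemma bl_name_act p l : bl_name (bl_act p l) = p (bl_name l).
Proof. by case: l. Qed.

Lemma bs_act_comp p q w : bs_act (p \o q) w = bs_act p (bs_act q w).
Proof. by rewrite /bs_act -map_comp; apply: eq_map => l; apply: bl_act_comp. Qed.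

Lemma bs_act_id w : bs_act id w = w.
Proof. by elim: w => //= l w ->; rewrite bl_act_id. Qed.

Lemma bs_names_act p w : bs_names (bs_act p w) = map p (bs_names w).
Proof. by elim: w => //= l w ->; rewrite bl_name_act. Qed.

Lemma eq_in_bs_act p q w : {in bs_names w, p =1 q} -> bs_act p w = bs_act q w.
Proof.
elim: w => //= l w IHw pq; rewrite IHw => [|x xw]; last first.
  by apply: pq; rewrite in_cons xw orbT.
by congr cons; case: l pq => a pq /=; rewrite pq // mem_head.
Qed.

Lemma bs_fn_names w : {subset bs_fn w <= bs_names w}.
Proof.
elim: w => //= -[a|a] w IHw x; rewrite !inE.
  by case/predU1P => [->|/IHw->]; rewrite ?eqxx ?orbT.
by rewrite mem_filter => /andP[_ /IHw->]; rewrite orbT.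
Qed.

Lemma bs_fn_act p w : injective p -> bs_fn (bs_act p w) = map p (bs_fn w).
Proof.
move=> p_inj; elim: w => //= -[a|a] w /= -> //.
by rewrite filter_map; congr map; apply: eq_filter => x /=; rewrite (inj_eq p_inj).
Qed.

Lemma abs_bs_act p a v b u : injective p -> abs_bs a v b u ->
  abs_bs (p a) (bs_act p v) (p b) (bs_act p u).
Proof.
move=> p_inj [c [ca [cb [cv [cu e]]]]]; exists (p c).
rewrite !(inj_eq p_inj) !bs_names_act !(mem_map p_inj); do !split => //.
by rewrite -2!bs_act_comp (swap_conj a c p_inj) (swap_conj b c p_inj) 2!(bs_act_comp p) e.
Qed.

Lemma abs_bs_swap a b v : (b \in bs_names v -> b = a) -> abs_bs a v b (bs_act (swap b a) v).
Proof.
move=> bv; have [c] := ex_fresh (a :: b :: bs_names v ++ bs_names (bs_act (swap b a) v)).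
rewrite !inE mem_cat !negb_or => /and4P[ca cb cv cu].
exists c; do !split => //; rewrite -bs_act_comp; apply: eq_in_bs_act => x xv /=.
by apply: swap_trans => // [|xb]; [apply: contraNneq cv => <- | apply: bv; rewrite -xb].
Qed.

(** * Alpha-equivalence of bar strings *)

Lemma alpha_act p w w' : injective p -> alpha w w' -> alpha (bs_act p w) (bs_act p w').
Proof.
move=> p_inj; elim=> {w w'} [w a v b u abu|w|w w' _ IH|w1 w2 w3 _ IH1 _ IH2].
- by rewrite /bs_act !map_cat; apply: alpha_step; apply: abs_bs_act.
- exact: alpha_refl.
- exact: alpha_sym.
- exact: alpha_trans IH1 IH2.
Qed.

Lemma alpha_cons l w w' : alpha w w' -> alpha (l :: w) (l :: w').
Proof.
elim=> {w w'} [w a v b u abu|w|w w' _ IH|w1 w2 w3 _ IH1 _ IH2].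
- by rewrite -!cat_cons; apply: alpha_step.
- exact: alpha_refl.
- exact: alpha_sym.
- exact: alpha_trans IH1 IH2.
Qed.

Lemma alpha_bar a b v : b \notin bs_names v ->
  alpha (Bar a :: v) (Bar b :: bs_act (swap a b) v).
Proof.
move=> bv;
rewrite swapC; apply: (@alpha_step [::]); apply: abs_bs_swap => b_in; by rewrite b_in in bv.
Qed.

Lemma alpha_size w w' : alpha w w' -> size w = size w'.
Proof.
elim=> {w w'} [w a v b u [c [_ [_ [_ [_ /(congr1 size)]]]]]|//|//|w1 w2 w3 _ -> _ ->//].
by rewrite !size_map !size_cat /= => ->.
Qed.

(** After both binders are renamed to [c], the name [x] is unmoved on the left. Its preimage [y] on
    the right is not [c], which is fresh for [u], and not [b], which would be sent to [c]; so [y] is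
    [x]. *)
Lemma abs_bs_fn a v b u x : abs_bs a v b u ->
  x \in bs_fn v -> x != a -> (x \in bs_fn u) && (x != b).
Proof.
move=> [c [ca [cb [cv [cu e]]]]] xv xa.
have xc : x != c by apply: contraNneq cv => <-; apply: bs_fn_names.
have : swap a c x \in bs_fn (bs_act (swap a c) v).
  by rewrite bs_fn_act ?map_f //; apply: swap_inj.
rewrite e bs_fn_act; last exact: swap_inj.
rewrite swapD // => /mapP[y yu exy].
have yc : y != c by apply: contraNneq cu => <-; apply: bs_fn_names.
have [yb|yb] := eqVneq y b; first by rewrite yb swapL in exy; rewrite exy eqxx in xc.
by rewrite swapD // in exy; rewrite exy yu.
Qed.

(** Serves to transfer closedness of a word to its alpha-variants. *)
Lemma alpha_fn w w' : alpha w w' -> bs_fn w =i bs_fn w'.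
Proof.
elim=> {w w'} [w a v b u abu|//|w w' _ IH x|w1 w2 w3 _ IH1 _ IH2 x].
- have bau : abs_bs b u a v.
    by case: abu => c [ca [cb [cv [cu e]]]]; exists c.
  elim: w => [|l w IHw] x; last by case: l => d /=; rewrite ?inE ?mem_filter IHw.
  rewrite /= !mem_filter; apply/andP/andP => -[xa xv].
    by have /andP[] := abs_bs_fn abu xv xa.
  by have /andP[] := abs_bs_fn bau xv xa.
- by rewrite IH.
- by rewrite IH1.
Qed.

(** * Renaming of formulae and equivariance of satisfaction *)

Lemma f_act_comp p q phi : f_act (p \o q) phi = f_act p (f_act q phi).
Proof.
elim: phi => //= [f -> g ->|f -> g ->|l f ->|l f ->|X ann|X f ->] //.
- by rewrite (bl_act_comp p q).
- by rewrite (bl_act_comp p q).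
- by rewrite -map_comp.
Qed.

Lemma f_act_id phi : f_act id phi = phi.
Proof.
by elim: phi => //= [f -> g ->|f -> g ->|l f ->|l f ->|X ann|X f ->] //;
  rewrite ?bl_act_id // map_id.
Qed.

Lemma f_names_act p phi : f_names (f_act p phi) = map p (f_names phi).
Proof.
by elim: phi => //= [f -> g ->|f -> g ->|l f ->|l f ->]; rewrite ?map_cat ?bl_name_act.
Qed.

Lemma eq_in_f_act p q phi : {in f_names phi, p =1 q} -> f_act p phi = f_act q phi.
Proof.
have bl_eq l : p (bl_name l) = q (bl_name l) -> bl_act p l = bl_act q l.
  by case: l => a /= ->.
elim: phi => //= [f IHf g IHg|f IHf g IHg|l f IHf|l f IHf|X ann|X f IHf] pq.
- by rewrite IHf ?IHg // => x xf; apply: pq; rewrite mem_cat xf ?orbT.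
- by rewrite IHf ?IHg // => x xf; apply: pq; rewrite mem_cat xf ?orbT.
- by rewrite IHf ?bl_eq // => [|x xf]; apply: pq; rewrite inE ?eqxx // xf orbT.
- by rewrite IHf ?bl_eq // => [|x xf]; apply: pq; rewrite inE ?eqxx // xf orbT.
- by congr FVar; apply/eq_in_map.
- by rewrite IHf.
Qed.

Lemma f_act_subst p X psi phi :
  f_act p (f_subst X psi phi) = f_subst X (f_act p psi) (f_act p phi).
Proof.
by elim: phi => //= [f -> g ->|f -> g ->|l f ->|l f ->|Y ann|Y f IHf] //;
  case: ifP => //= _; rewrite IHf.
Qed.

Lemma abs_form_act p a phi b psi : injective p -> abs_form a phi b psi ->
  abs_form (p a) (f_act p phi) (p b) (f_act p psi).
Proof.
move=> p_inj [c [ca [cb [cv [cu e]]]]]; exists (p c).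
rewrite !(inj_eq p_inj) !f_names_act !(mem_map p_inj); do !split => //.
by rewrite -2!f_act_comp (swap_conj a c p_inj) (swap_conj b c p_inj) 2!(f_act_comp p) e.
Qed.

(** The witness of an abstraction equality can be any fresh name: apply the swap of the given
    witness [d] with [c] to both sides. *)
Lemma abs_form_fresh a phi b psi c : abs_form a phi b psi ->
  c \notin f_names phi -> c \notin f_names psi ->
  f_act (swap a c) phi = f_act (swap b c) psi.
Proof.
move=> [d [da [db [dphi [dpsi e]]]]] cphi cpsi.
have via a' chi : d \notin f_names chi -> c \notin f_names chi ->
    f_act (swap a' c) chi = f_act (swap d c) (f_act (swap a' d) chi).
  move=> dchi cchi; rewrite -f_act_comp; apply: eq_in_f_act => x xchi /=.
  by apply: swap_via; [apply: contraNneq dchi => <-|apply: contraNneq cchi => <-].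
by rewrite via // e -via.
Qed.

Lemma abs_form_swap a b phi : (b \in f_names phi -> b = a) ->
  abs_form a phi b (f_act (swap b a) phi).
Proof.
move=> bv; have [c] := ex_fresh (a :: b :: f_names phi ++ f_names (f_act (swap b a) phi)).
rewrite !inE mem_cat !negb_or => /and4P[ca cb cv cu].
exists c; do !split => //; rewrite -f_act_comp; apply: eq_in_f_act => x xv /=.
by apply: swap_trans => // [|xb]; [apply: contraNneq cv => <- | apply: bv; rewrite -xb].
Qed.

Lemma sat_act p S w phi : finperm p -> sat S w phi ->
  sat (map p S) (bs_act p w) (f_act p phi).
Proof.
move=> fp; have [q [/finperm_inj q_inj pK qK]] := finperm_inv fp.
have p_inj := finperm_inj fp.
have qpw w' : bs_act q (bs_act p w') = w'.
  by rewrite -bs_act_comp (_ : q \o p = id) ?bs_act_id //; apply/funext.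
have pqw w' : bs_act p (bs_act q w') = w'.
  by rewrite -bs_act_comp (_ : p \o q = id) ?bs_act_id //; apply/funext.
have qpf f : f_act q (f_act p f) = f.
  by rewrite -f_act_comp (_ : q \o p = id) ?f_act_id //; apply/funext.
have pqf f : f_act p (f_act q f) = f.
  by rewrite -f_act_comp (_ : p \o q = id) ?f_act_id //; apply/funext.
elim=> {S w phi} /=.
- by move=> S; apply: sat_eps.
- by move=> S l w; apply: sat_neps.
- by move=> S w f g _ IHf _ IHg; apply: sat_and.
- by move=> S w f g _ IHf; apply: sat_orl.
- by move=> S w f g _ IHg; apply: sat_orr.
- by move=> S w X f _; rewrite f_act_subst; apply: sat_mu.
- by move=> S a v f _; apply: sat_dia.
(* In the box cases the word, and for a bar also the formula, is arbitrary; it is pulled back along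
   the inverse [q] of [p] to meet the induction hypothesis. *)
- move=> S w a f _ IHf; apply: sat_box => v e; rewrite -(pqw v); apply: IHf.
  by rewrite -(qpw w) e /= pK.
- move=> S w a f psi v b wv ab _ IHf.
  apply: (sat_diabar (b := p b) (v := bs_act p v) (psi := f_act p psi)) => //.
    exact: (alpha_act p_inj wv).
  exact: abs_form_act.
- move=> S w a f _ IHf; apply: sat_boxbar => psi v b wv ab.
  rewrite -(pqf psi) -(pqw v) -(qK b); apply: (IHf (f_act q psi) (bs_act q v) (q b)).
    by rewrite -(qpw w); apply: (alpha_act q_inj wv).
  by rewrite -(pK a) -(qpf f); apply: abs_form_act.
Qed.

(** * Least supports *)

Section Nominal.
Variable Q : nominal_set.
Implicit Types (x y : Q) (S T : seq nat).
Local Notation act := (@nom_act Q).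
Local Notation supp := (supports act).

Lemma actK p q x : finperm p -> finperm q -> cancel p q -> act q (act p x) = x.
Proof.
move=> fp fq pK; rewrite -nom_act_comp //.
by rewrite (_ : q \o p = id) ?nom_act_id //; apply/funext.
Qed.

Lemma act_swapK a b x : act (swap a b) (act (swap a b) x) = x.
Proof. by apply: actK; [exact: finperm_swap..|exact: swapK]. Qed.

Lemma supports_eq S x p q : supp S x -> finperm p -> finperm q -> {in S, p =1 q} ->
  act p x = act q x.
Proof.
move=> Sx fp fq pq; have [r [fr qK rK]] := finperm_inv fq.
have : act (r \o p) x = x.
  by apply: Sx => [|a aS]; [exact: finperm_comp | rewrite /= pq // qK].
by rewrite nom_act_comp // => {2}<-; rewrite (actK _ fr fq rK).
Qed.

Lemma supports_act S x p : finperm p -> supp S x -> supp (map p S) (act p x).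
Proof.
move=> fp Sx q fq qS; rewrite -nom_act_comp //.
apply: (supports_eq Sx) => // [|a aS]; first exact: finperm_comp.
by apply: qS; apply: map_f.
Qed.

Lemma fresh_act p a x : finperm p -> fresh a x -> fresh (p a) (act p x).
Proof.
move=> fp [S [Sx aS]]; exists (map p S); split; first exact: supports_act.
by rewrite mem_map //; apply: finperm_inj.
Qed.

Lemma fresh_actI p a x : finperm p -> fresh (p a) (act p x) -> fresh a x.
Proof.
move=> fp; have [q [fq pK qK]] := finperm_inv fp.
by move=> /(fresh_act fq); rewrite pK actK.
Qed.

(* If p fixes S minus a, conjugating p by (a b) for a totally fresh b gives a
   permutation fixing S, and (a b) fixes x since a is fresh. *)
Lemma supports_shrink S x a : supp S x -> fresh a x ->
  supp [seq b <- S | b != a] x.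
Proof.
move=> Sx [T [Tx aT]] p fp pS; have [_ [U pU]] := fp.
have [b] := ex_fresh (a :: S ++ T ++ U).
rewrite inE !mem_cat !negb_or => /and4P[ba bS bT bU].
have fab := finperm_swap a b.
have abx : act (swap a b) x = x.
  by apply: Tx => // c cT; apply: swapD; [apply: contraNneq aT | apply: contraNneq bT] => <-.
have : act (swap a b \o (p \o swap a b)) x = x.
  apply: Sx => [|c cS]; first by do !apply: finperm_comp => //.
  have [->|ca] := eqVneq c a; first by rewrite /= swapL pU // swapC swapL.
  have cb : c != b by apply: contraNneq bS => <-.
  by rewrite /= swapD // pS ?swapD // mem_filter ca.
have fpab := finperm_comp fp fab.
rewrite (nom_act_comp x fab fpab) (nom_act_comp x fp fab).
by rewrite abx => /(congr1 (act (swap a b))); rewrite act_swapK abx.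
Qed.

(** Starting from any finite support, the names fresh for [x] are deleted one at a time by
    [supports_shrink]. *)
Lemma least_support x : exists S, supp S x /\ forall a, fresh a x -> a \notin S.
Proof.
have [S Sx] := nom_fin_supp x.
pose keep a := ~~ `[< fresh a x >].
exists [seq a <- S | keep a]; split; last first.
  by move=> a afr; rewrite mem_filter /keep asboolT.
have shrink T : (forall a, a \in T -> fresh a x) -> supp [seq a <- S | a \notin T] x.
  elim: T => [|a T IHT] Tfr; first by rewrite (eq_filter (a2 := predT)) ?filter_predT.
  have -> : [seq b <- S | b \notin a :: T] = [seq b <- [seq b <- S | b \notin T] | b != a].
    by rewrite -filter_predI; apply: eq_filter => b; rewrite /= inE negb_or.
  apply: supports_shrink; last exact/Tfr/mem_head.
  by apply: IHT => b bT; apply: Tfr; rewrite inE bT orbT.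
have -> : [seq a <- S | keep a] = [seq a <- S | a \notin [seq b <- S | ~~ keep b]].
  by apply: eq_in_filter => a aS; rewrite mem_filter aS andbT negbK.
by apply: shrink => a; rewrite mem_filter negbK => /andP[/asboolP].
Qed.

Lemma ex_fresh_nom (s : seq nat) (xs : list Q) :
  exists c, c \notin s /\ forall x, List.In x xs -> fresh c x.
Proof.
elim: xs s => [|x xs IHxs] s; first by have [c cs] := ex_fresh s; exists c.
have [S Sx] := nom_fin_supp x; have [c [+ cxs]] := IHxs (s ++ S).
rewrite mem_cat negb_or => /andP[cs cS]; exists c; split => // y [<-|/cxs//].
by exists S.
Qed.

Lemma absQ_swap a b x : (b = a \/ fresh b x) -> absQ a x b (act (swap b a) x).
Proof.
move=> bx; have [S [Sx Sfr]] := least_support x.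
have [c []] := ex_fresh_nom (a :: b :: S) [:: x; act (swap b a) x].
rewrite !inE !negb_or => /and3P[ca cb cS] cfr.
exists c; do !split => //; [by apply: cfr; left| by apply: cfr; right; left|].
rewrite -nom_act_comp; [|exact: finperm_swap..].
apply: (supports_eq Sx) => [||y yS /=]; [exact: finperm_swap| |].
  by apply: finperm_comp; apply: finperm_swap.
apply: swap_trans => // [|yb]; first by apply: contraNneq cS => <-.
by case: bx => // /Sfr; rewrite -yb yS.
Qed.

(** Renaming both binders to the witness [c] gives one common element, and neither swap moves [d]
    unless [d] is [c], which is fresh for [x] by choice. *)
Lemma absQ_fresh a x b y d : absQ a x b y -> d != a -> d != b -> fresh d y -> fresh d x.
Proof.
move=> [c [ca [cb [cx [cy e]]]]] da db dy.
have [->//|dc] := eqVneq d c.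
apply: (@fresh_actI (swap a c)); first exact: finperm_swap.
rewrite e swapD // -(swapD db dc).
by apply: fresh_act => //; apply: finperm_swap.
Qed.

Lemma fresh_swap a b x : fresh a x -> fresh b (act (swap a b) x).
Proof. by move=> /(fresh_act (finperm_swap a b)); rewrite swapL. Qed.

(** * Finiteness of the set of states supported by given names *)

Definition supported_in (N : seq nat) x := forall a, a \notin N -> fresh a x.

(** A renaming preserves the size of a support, so the maximum over the finitely many orbit
    representatives is a bound. *)
Lemma support_bound : orbit_finite Q ->
  exists k, forall x, exists S, supp S x /\ size S <= k.
Proof.
move=> [reps repsP].
have [k kP] : exists k, forall r, List.In r reps -> exists S, supp S r /\ size S <= k.
  elim: reps {repsP} => [|r reps [k IHk]]; first by exists 0.
  have [S Sr] := nom_fin_supp r; exists (maxn (size S) k) => r' [<-|/IHk[T [Tr' Tk]]].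
    by exists S; rewrite leq_maxl.
  by exists T; rewrite leq_max Tk orbT.
exists k => x; have [r [/kP[S [Sr Sk]] [p [fp ->]]]] := repsP x.
by exists (map p S); rewrite size_map; split=> //; apply: supports_act.
Qed.

Fixpoint words (N : seq nat) n : seq (seq nat) :=
  if n is n'.+1 then [seq a :: t | a <- N, t <- words N n'] else [:: [::]].

Lemma mem_words N t : {subset t <= N} -> t \in words N (size t).
Proof.
elim: t => [|a t IHt] tN; first by rewrite inE.
apply/allpairsP; exists (a, t); split => //=; first exact/tN/mem_head.
by apply: IHt => b bt; apply: tN; rewrite inE bt orbT.
Qed.

(** An element [act p r] depends only on the values of [p] on the least support [S] of [r]. These
    values lie in [N] when [act p r] is supported in [N], so [map p S] is one of finitely many
    words. *)
Lemma supported_in_finite N : orbit_finite Q ->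
  exists l : list Q, forall x, supported_in N x -> List.In x l.
Proof.
move=> [reps repsP].
suff [l lP] : exists l : list Q, forall r p, List.In r reps -> finperm p ->
    supported_in N (act p r) -> List.In (act p r) l.
  by exists l => x; have [r [rr [p [fp ->]]]] := repsP x; apply: lP.
elim: reps {repsP} => [|r reps [l lP]]; first by exists [::].
have [S [Sr Sfr]] := least_support r.
suff [l' l'P] : exists l' : list Q, forall p, finperm p ->
    map p S \in words N (size S) -> List.In (act p r) l'.
  exists (l' ++ l)%list => r' p [<-|r'r] fp pN; apply: List.in_or_app; last first.
    by right; apply: lP.
  left; apply: l'P => //; rewrite -(size_map p); apply: mem_words => _ /mapP[a aS ->].
  apply: contraLR aS => /pN pa; apply: Sfr; exact: fresh_actI pa.
elim: (words N (size S)) => [|t ts [l' IHl]]; first by exists [::].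
(* One permutation [q] is chosen for each word that is realised; every other one with the same
   values on [S] yields the same element. *)
have [[q [fq qt]]|no] := EM (exists q, finperm q /\ map q S = t); last first.
  exists l' => p fp; rewrite inE => /predU1P[pt|/(IHl _ fp)//].
  by case: no; exists p.
exists (act q r :: l') => p fp; rewrite inE => /predU1P[pt|/(IHl _ fp)]; last by right.
left; apply: (supports_eq Sr) => //; apply/eq_in_map; by rewrite pt.
Qed.

End Nominal.

(** * Formulae from finite automata *)

Fixpoint closed_in (V : seq nat) (phi : form) : bool :=
  match phi with
  | FEps | FNEps => true
  | FAnd f g | FOr f g => closed_in V f && closed_in V g
  | FDia _ f | FBox _ f => closed_in V f
  | FVar X _ => X \in V
  | FMu X f => closed_in (X :: V) f
  end.

Lemma closed_in_sub V W phi : {subset V <= W} -> closed_in V phi -> closed_in W phi.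
Proof.
elim: phi V W => //= [f IHf g IHg|f IHf g IHg|X _|X f IHf] V W VW.
- by case/andP => /(IHf V W VW)-> /(IHg V W VW)->.
- by case/andP => /(IHf V W VW)-> /(IHg V W VW)->.
- exact: VW.
- by apply: IHf => Y; rewrite !inE => /predU1P[->|/VW->]; rewrite ?eqxx ?orbT.
Qed.

Lemma f_subst_closed V X psi phi : closed_in V phi -> X \notin V -> f_subst X psi phi = phi.
Proof.
elim: phi V => //= [f IHf g IHg|f IHf g IHg|l f IHf|l f IHf|Y ann|Y f IHf] V.
- by move=> /andP[fV gV] XV; rewrite (IHf V) ?(IHg V).
- by move=> /andP[fV gV] XV; rewrite (IHf V) ?(IHg V).
- by move=> fV XV; rewrite (IHf V).
- by move=> fV XV; rewrite (IHf V).
- by move=> YV; case: eqP => // <-; rewrite YV.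
- case: eqVneq => // YX fV XV; rewrite (IHf (Y :: V)) //.
  by rewrite inE negb_or eq_sym YX.
Qed.

Lemma closed_in_subst V X psi phi : closed_in [::] psi -> closed_in (X :: V) phi ->
  closed_in V (f_subst X psi phi).
Proof.
move=> psi0; elim: phi V => //= [f IHf g IHg|f IHf g IHg|Y ann|Y f IHf] V.
- by case/andP => /IHf-> /IHg->.
- by case/andP => /IHf-> /IHg->.
- by rewrite inE; case: eqP => //= _ _; apply: closed_in_sub psi0.
- move=> fV; case: eqVneq fV => /= [->|YX] fV.
    by apply: closed_in_sub fV => Z; rewrite !inE; case: eqP => //= _ ->.
  apply: IHf; by apply: closed_in_sub fV => Z; rewrite !inE orbCA.
Qed.

Lemma f_names_subst X psi phi :
  {subset f_names (f_subst X psi phi) <= f_names phi ++ f_names psi}.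
Proof.
move=> x; rewrite mem_cat.
elim: phi => //= [f IHf g IHg|f IHf g IHg|l f IHf|l f IHf|Y ann|Y f IHf].
- by rewrite !mem_cat => /orP[/IHf|/IHg] /orP[]->; rewrite ?orbT.
- by rewrite !mem_cat => /orP[/IHf|/IHg] /orP[]->; rewrite ?orbT.
- by rewrite !inE => /orP[->//|/IHf/orP[]->]; rewrite ?orbT.
- by rewrite !inE => /orP[->//|/IHf/orP[]->]; rewrite ?orbT.
- by case: ifP => _ ->; rewrite ?orbT.
- by case: ifP => // _ /= ->.
Qed.

Lemma f_fn_names phi : {subset f_fn phi <= f_names phi}.
Proof.
elim: phi => //= [f IHf g IHg|f IHf g IHg|[a|a] f IHf|[a|a] f IHf] x.
- by rewrite !mem_cat => /orP[/IHf|/IHg]->; rewrite ?orbT.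
- by rewrite !mem_cat => /orP[/IHf|/IHg]->; rewrite ?orbT.
- by rewrite !inE => /orP[->//|/IHf->]; rewrite orbT.
- by rewrite mem_filter inE => /andP[_ /IHf->]; rewrite orbT.
- by rewrite !inE => /orP[->//|/IHf->]; rewrite orbT.
- by rewrite mem_filter inE => /andP[_ /IHf->]; rewrite orbT.
Qed.

Section Disjunction.
Variables (base : form) (T : eqType).
Implicit Types (s : seq (bletter * T)) (g : bletter * T -> form).

(** The body of the fixpoint of a state: it may stop through [base] or take one of its edges. *)
Definition disj s g := foldr (fun e phi => FOr (FDia e.1 (g e)) phi) base s.

Hypothesis base_fn : f_fn base = [::].

Lemma eq_disj_fn s g g' : (forall e, f_fn (g e) = f_fn (g' e)) ->
  f_fn (disj s g) = f_fn (disj s g').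
Proof. by move=> gg'; elim: s => //= -[[a|a] j] s -> /=; rewrite gg'. Qed.

Lemma disj_fn s g x : x \in f_fn (disj s g) ->
  exists2 e, e \in s & x \in f_fn (FDia e.1 (g e)).
Proof.
elim: s => [|e s IHs]; first by rewrite /= base_fn.
have -> : f_fn (disj (e :: s) g) = f_fn (FDia e.1 (g e)) ++ f_fn (disj s g) by [].
rewrite mem_cat => /orP[xe|/IHs[e' e's xe']]; first by exists e; rewrite ?mem_head.
by exists e'; rewrite // inE e's orbT.
Qed.

Lemma disj_names s g (N : seq nat) : {subset f_names base <= N} ->
  (forall e, e \in s -> bl_name e.1 \in N /\ {subset f_names (g e) <= N}) ->
  {subset f_names (disj s g) <= N}.
Proof.
move=> baseN; elim: s => //= e s IHs eN x.
have [e1N geN] := eN e (mem_head _ _).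
rewrite inE mem_cat => /orP[/eqP->//|/orP[/geN//|]].
by apply: IHs => e' e's; apply: eN; rewrite inE e's orbT.
Qed.

Lemma disj_closed V s g : closed_in V base -> (forall e, e \in s -> closed_in V (g e)) ->
  closed_in V (disj s g).
Proof.
move=> bV; elim: s => //= e s IHs gV; rewrite gV ?mem_head //=.
by apply: IHs => e' e's; apply: gV; rewrite inE e's orbT.
Qed.

Lemma disj_wf env s g : wf_form env base ->
  (forall e, e \in s -> wf_form env (g e)) -> wf_form env (disj s g).
Proof.
move=> bV; elim: s => //= e s IHs gV; rewrite gV ?mem_head //=.
by apply: IHs => e' e's; apply: gV; rewrite inE e's orbT.
Qed.

Lemma disj_guarded X s g : guarded X base -> guarded X (disj s g).
Proof. by move=> bX; elim: s. Qed.

Lemma disj_subst X psi s g : f_subst X psi base = base ->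
  f_subst X psi (disj s g) = disj s (fun e => f_subst X psi (g e)).
Proof. by move=> bX; elim: s => //= e s ->. Qed.

Lemma sat_disj p S w s g : f_act p base = base ->
  sat S w (f_act p (disj s g)) <->
  sat S w base \/
  exists2 e, e \in s & sat S w (FDia (bl_act p e.1) (f_act p (g e))).
Proof.
move=> bp; elim: s => [|e s [IHl IHr]]; rewrite /= ?bp.
  by split=> [|[//|[]//]]; left.
split.
  move=> H; inversion H; subst; first by right; exists e; rewrite ?mem_head.
  case: (IHl _) => // [|[e' e's]]; [by left | right].
  by exists e'; rewrite // inE e's orbT.
move=> H; have [He|[]] : sat S w (FDia (bl_act p e.1) (f_act p (g e))) \/
    (sat S w base \/ exists2 e, e \in s & sat S w (FDia (bl_act p e.1) (f_act p (g e)))).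
- case: H => [|[e']]; first by right; left.
  rewrite inE => /predU1P[->|e's]; first by left.
  by right; right; exists e'.
- exact: sat_orl.
- by move=> ?; apply: sat_orr; apply: IHr; left.
- by move=> ?; apply: sat_orr; apply: IHr; right.
Qed.

End Disjunction.

(** * Unravelling a finite automaton into nested fixpoints *)

Section Unfolding.
Variables (n : nat) (N : seq nat) (acc top : nat -> bool).
Variable E : nat -> seq (bletter * nat).

(** The three cases are truth, emptiness of the remaining word, and falsity. *)
Definition base i :=
  if top i then FOr FEps FNEps else if acc i then FEps else FAnd FEps FNEps.

Definition node i g := disj (base i) (E i) g.

(** States serve as variable names; [env] lists those already bound, with their annotations, and [m]
    is fuel. The annotation is computed from the body with an empty annotation, because variables
    contribute no free names. *)
Fixpoint build m (env : seq (nat * seq nat)) i : form :=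
  if lookup i env is Some T then FVar i T else
  if m is m'.+1 then
    let body T := node i (fun e => build m' ((i, T) :: env) e.2) in
    FMu i (body (f_fn (body [::])))
  else FEps.

(** The head of [th] belongs to the innermost binder and is substituted last, which is exactly what
    unfolding that fixpoint does. *)
Fixpoint close (th : seq (nat * form)) phi :=
  if th is (X, psi) :: th' then f_subst X psi (close th' phi) else phi.

(** Says that [psi] behaves like state [i] for [k] unfoldings. The successors [g] are existential
    because the formula reached for a state depends on the path taken to it. The bound on names
    makes every name outside [N] fresh for [psi]. *)
Fixpoint rep k i psi : Prop :=
  [/\ {subset f_names psi <= N}, closed_in [::] psi &
    if k is k'.+1 then
      exists X phi g, [/\ psi = FMu X phi, f_subst X psi phi = node i g &
        forall e, e \in E i -> rep k' e.2 (g e)]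
    else True].

Hypothesis E_name : forall i e, e \in E i -> bl_name e.1 \in N.
Hypothesis E_state : forall i e, e \in E i -> e.2 < n.

Lemma base_fn i : f_fn (base i) = [::].
Proof. by rewrite /base; do !case: ifP. Qed.

Lemma base_names i : f_names (base i) = [::].
Proof. by rewrite /base; do !case: ifP. Qed.

Lemma base_act p i : f_act p (base i) = base i.
Proof. by rewrite /base; do !case: ifP. Qed.

Lemma base_subst X psi i : f_subst X psi (base i) = base i.
Proof. by rewrite /base; do !case: ifP. Qed.

Lemma lookup_mem i env : lookup i env = None <-> i \notin map fst env.
Proof.
elim: env => //= -[j T] env IH; rewrite inE negb_or eq_sym.
by case: eqVneq => //= _; split.
Qed.

Lemma buildE m env i : build m env i =
  if lookup i env is Some T then FVar i T else
  if m is m'.+1 then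
    FMu i (node i (fun e => build m'
      ((i, f_fn (node i (fun e => build m' ((i, [::]) :: env) e.2))) :: env) e.2))
  else FEps.
Proof. by case: m. Qed.

(** Free names depend on which states are bound, not on the annotations; this justifies computing
    the annotation with an empty one. *)
Lemma build_fn m env env' i : map fst env = map fst env' ->
  f_fn (build m env i) = f_fn (build m env' i).
Proof.
elim: m env env' i => [|m IHm] env env' i ee; rewrite !buildE.
  have := lookup_mem i env; have := lookup_mem i env'; rewrite ee.
  by case: (lookup i env) => [?|]; case: (lookup i env').
have := lookup_mem i env; have := lookup_mem i env'; rewrite ee.
case: (lookup i env) => [?|]; case: (lookup i env') => [?|] // [H1 H2] [H3 H4].
- by have := H4 (H1 erefl).
- by have := H2 (H3 erefl).
- by apply: eq_disj_fn => e; apply: IHm; rewrite /= ee.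
Qed.

Lemma lookup_sub (env : seq (nat * seq nat)) i T : (forall e, e \in env -> {subset e.2 <= N}) ->
  lookup i env = Some T -> {subset T <= N}.
Proof.
elim: env => //= -[j U] env IH eN; case: eqP => [_ [<-]|_].
  by apply: (eN (j, U)); rewrite mem_head.
by apply: IH => e ee; apply: eN; rewrite inE ee orbT.
Qed.

Lemma build_names m (env : seq (nat * seq nat)) i :
  (forall e, e \in env -> {subset e.2 <= N}) -> {subset f_names (build m env i) <= N}.
Proof.
elim: m env i => [|m IHm] env i eN; rewrite buildE;
  case e: (lookup i env) => [T|] //=; try exact: (lookup_sub eN e).
have bodyN T : {subset T <= N} ->
    {subset f_names (node i (fun e => build m ((i, T) :: env) e.2)) <= N}.
  move=> TN; apply: disj_names => [x|e' e'E]; first by rewrite base_names.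
  split; first exact: E_name e'E.
  by apply: IHm => // e2; rewrite inE => /predU1P[->|/eN].
by apply: (bodyN) => x /f_fn_names; apply: bodyN.
Qed.

Lemma build_closed m env i : closed_in (map fst env) (build m env i).
Proof.
elim: m env i => [|m IHm] env i; rewrite buildE;
  case e: (lookup i env) => [T|] //=.
- by apply: contraT => /lookup_mem; rewrite e.
- by apply: contraT => /lookup_mem; rewrite e.
- apply: disj_closed => [|e' _]; last exact: IHm.
  by rewrite /base; do !case: ifP.
Qed.

Lemma build_wf m env i : wf_form env (build m env i).
Proof.
have same_refl T : same_set T T by rewrite /same_set andbb; apply/allP.
elim: m env i => [|m IHm] env i; rewrite buildE;
  case e: (lookup i env) => [T|] //=; rewrite ?e ?same_refl //.
rewrite disj_guarded /=; last by rewrite /base; do !case: ifP.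
apply: disj_wf => [|e' _]; first by rewrite /base; do !case: ifP.
(* The annotation must equal the free names of the final body, which already carries that
   annotation. *)
set T0 := f_fn (node i (fun e => build m ((i, [::]) :: env) e.2)).
have -> : f_fn (node i (fun e => build m ((i, T0) :: env) e.2)) = T0.
  by apply: eq_disj_fn => e2; apply: build_fn.
exact: IHm.
Qed.

Lemma rep_names k i psi : rep k i psi -> {subset f_names psi <= N}.
Proof. by case: k => [|k] []. Qed.

Lemma rep_closed k i psi : rep k i psi -> closed_in [::] psi.
Proof. by case: k => [|k] []. Qed.

Lemma rep_weak k i psi : rep k.+1 i psi -> rep k i psi.
Proof.
elim: k i psi => [|k IHk] i psi; first by case.
case=> psiN psi0 [X [phi [g [e u gE]]]]; split => //; exists X, phi, g; split => // d dE.
by apply: IHk; apply: gE.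
Qed.

Lemma close_names th phi : (forall e, List.In e th -> {subset f_names e.2 <= N}) ->
  {subset f_names phi <= N} -> {subset f_names (close th phi) <= N}.
Proof.
elim: th => //= -[X psi] th IH thN phiN x /f_names_subst; rewrite mem_cat => /orP[].
  by apply: IH => // e eth; apply: thN; right.
by apply: (thN (X, psi)); left.
Qed.

Lemma close_closed th V W phi : (forall e, List.In e th -> closed_in [::] e.2) ->
  closed_in V phi -> {subset V <= map fst th ++ W} -> closed_in W (close th phi).
Proof.
elim: th W => [|[X psi] th IH] W th0 phiV VW /=; first exact: closed_in_sub phiV.
apply: closed_in_subst; first by apply: (th0 (X, psi)); left.
apply: IH => // [e eth|Y /VW]; first by apply: th0; right.
by rewrite /= !(inE, mem_cat) orbCA.
Qed.

Lemma close_var th X T : (forall e, List.In e th -> closed_in [::] e.2) ->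
  uniq (map fst th) -> X \in map fst th ->
  exists2 psi, List.In (X, psi) th & close th (FVar X T) = psi.
Proof.
have close_id th' : X \notin map fst th' -> close th' (FVar X T) = FVar X T.
  elim: th' => //= -[Y psi] th' IH; rewrite inE negb_or => /andP[XY /IH->] /=.
  by rewrite (negPf XY).
elim: th => //= -[Y chi] th IH th0 /andP[Yth uth]; rewrite inE.
case: eqVneq => [XY _|_ /= Xth].
  by rewrite /= in XY; subst Y; exists chi; [left | rewrite close_id //= eqxx].
have [|psi psith ->] := IH _ uth Xth; first by move=> e eth; apply: th0; right.
exists psi; first by right.
by apply: (@f_subst_closed [::]) => //; apply: (th0 (X, psi)); right.
Qed.

Lemma close_mu th X phi : X \notin map fst th -> close th (FMu X phi) = FMu X (close th phi).
Proof.
elim: th => //= -[Y psi] th IH; rewrite inE negb_or => /andP[XY /IH->] /=.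
by rewrite (negPf XY).
Qed.

Lemma close_node th i g : close th (node i g) = node i (fun e => close th (g e)).
Proof. by elim: th => //= -[X psi] th ->; apply/disj_subst/base_subst. Qed.

(* In the induction step, the bound variable i is closed by the formula under
   consideration, which represents i at the previous level by induction. *)
Lemma rep_build k m (env : seq (nat * seq nat)) th i : i < n ->
  uniq (map fst env) -> {subset map fst env <= iota 0 n} -> n <= m + size env ->
  map fst th = map fst env -> (forall e, List.In e th -> rep k e.1 e.2) ->
  (forall e, e \in env -> {subset e.2 <= N}) ->
  rep k i (close th (build m env i)).
Proof.
elim: k m env th i => [|k IHk] m env th i lt_in uenv envn le_n thenv thk envN.
  split => //; first by apply: close_names => [e /thk[]//|]; apply: build_names.
  apply: close_closed (build_closed m env i) _ => [e /thk[]//|].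
  by rewrite cats0 thenv.
have th0 e : List.In e th -> closed_in [::] e.2 by move=> /thk/rep_closed.
have [ienv|ienv] := boolP (i \in map fst env).
  rewrite buildE; case e: (lookup i env) => [T|].
    have [||psi psith ->] := @close_var th i T th0; rewrite ?thenv //; exact: (thk _ psith).
  by move/lookup_mem: e; rewrite ienv.
have psik : rep k i (close th (build m env i)).
  by apply: IHk => // e eth; apply/rep_weak/thk.
split; [exact: rep_names psik | exact: rep_closed psik|].
move: psik; rewrite buildE; move/lookup_mem: (ienv) => ->.
(* Without fuel, the distinct states in [env] exhaust all [n] of them, so [i] would be bound; the
   default of [build] is never reached. *)
case: m le_n => [|m] le_n.
  have [|_ eqi] := uniq_min_size uenv envn; first by rewrite size_iota size_map.
  by rewrite eqi mem_iota lt_in in ienv.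
set T := f_fn _; set body := node i _.
have TN : {subset T <= N}.
  move=> x /f_fn_names; apply: disj_names x => [x|d dE]; first by rewrite base_names.
  split; first exact: E_name dE.
  by apply: build_names => d'; rewrite inE => /predU1P[->|/envN].
rewrite close_mu ?thenv // => psik.
pose th' := (i, FMu i (close th body)) :: th.
exists i, (close th body), (fun e => close th' (build m ((i, T) :: env) e.2)).
split => //; first exact: (close_node th' i).
move=> e eE; apply: IHk => //=.
- exact: E_state eE.
- by rewrite ienv.
- by move=> j; rewrite inE => /predU1P[->|/envn//]; rewrite mem_iota.
- by rewrite addnS.
- by rewrite thenv.
- by move=> d [<-//|/thk/rep_weak].
- by move=> d; rewrite inE => /predU1P[->|/envN].
Qed.

End Unfolding.

(** * From nominal to finite automata *)

Lemma In_mem (T : eqType) (x : T) (s : list T) : List.In x s -> x \in s.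
Proof. by elim: s => //= y s IH [->|/IH]; rewrite inE ?eqxx // => ->; rewrite orbT. Qed.

Lemma act_swap_fresh (Q : nominal_set) c d (x : Q) : fresh c x -> fresh d x ->
  nom_act (swap c d) x = x.
Proof.
have [S [Sx Sfr]] := least_support x; move=> /Sfr cS /Sfr dS.
apply: Sx => [|a aS]; first exact: finperm_swap.
by apply: swapD; [apply: contraNneq cS | apply: contraNneq dS] => <-.
Qed.

Section Automaton.
Variables (Q : nominal_set) (trans : Q -> option bletter -> Q -> Prop).
Variables (s : Q) (f : Q -> fval).
Hypothesis A : is_ernna trans s f.
Local Notation act := (@nom_act Q).
Local Notation run := (run trans).

Lemma trans_act p q o q' : finperm p -> trans q o q' ->
  trans (act p q) (omap (bl_act p) o) (act p q').
Proof. by have [_ [_ [H _]]] := A; apply: H. Qed.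

Lemma final_act p q : finperm p -> f (act p q) = f q.
Proof. by have [_ [_ [_ [H _]]]] := A; apply: H. Qed.

Lemma trans_bar_alpha q a q' b q'' : trans q (Some (Bar a)) q' -> absQ a q' b q'' ->
  trans q (Some (Bar b)) q''.
Proof. by have [_ [_ [_ [_ [H _]]]]] := A; apply: H. Qed.

(* If c is fresh for q, swapping c with a name d fresh for everything in sight,
   in particular for the finitely many successors of q, yields another transition
   of q; its target is one of those successors, so d is fresh for it. *)
Lemma trans_plain_fresh q a q' c : trans q (Some (Plain a)) q' -> fresh c q ->
  c != a /\ fresh c q'.
Proof.
have [_ [_ [_ [_ [_ [/(_ q)[[l lP] _] _]]]]]] := A => qq' cq.
have [d [dl dfr]] := ex_fresh_nom (List.map fst l) (q :: List.map snd l).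
have fcd := finperm_swap c d.
have dq : fresh d q by apply: dfr; left.
have := trans_act fcd qq'; rewrite act_swap_fresh //= => /lP al.
split; last first.
  apply: (fresh_actI fcd); rewrite swapL; apply: dfr; right.
  by have := List.in_map snd _ _ al.
apply: contraNneq dl => ca; have /In_mem := List.in_map fst _ _ al.
by rewrite /= ca swapL.
Qed.

(** The same swapping argument as for plain letters, with the finite list of silent successors. *)
Lemma trans_eps_fresh q q' c : trans q None q' -> fresh c q -> fresh c q'.
Proof.
have [_ [_ [_ [_ [_ [/(_ q)[_ [[l lP] _]] _]]]]]] := A => qq' cq.
have [d [_ dfr]] := ex_fresh_nom [::] (q :: l).
have fcd := finperm_swap c d.
have dq : fresh d q by apply: dfr; left.
have := trans_act fcd qq'; rewrite act_swap_fresh //= => /lP al.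
by apply: (fresh_actI fcd); rewrite swapL; apply: dfr; right.
Qed.

(** Here the successors are listed only up to alpha-equivalence, so [d] also avoids [a] and the
    listed binders, and freshness is carried across by [absQ_fresh]. *)
Lemma trans_bar_fresh q a q' c : trans q (Some (Bar a)) q' -> fresh c q -> c != a ->
  fresh c q'.
Proof.
have [_ [_ [_ [_ [_ [/(_ q)[_ [_ [l lP]]] _]]]]]] := A => qq' cq ca.
have [d [+ dfr]] := ex_fresh_nom (a :: List.map fst l) (q :: List.map snd l).
rewrite inE negb_or => /andP[da dl].
have fcd := finperm_swap c d.
have dq : fresh d q by apply: dfr; left.
have := trans_act fcd qq'.
rewrite act_swap_fresh //= swapD 1?eq_sym // => /lP[b [r [brl ab]]].
apply: (fresh_actI fcd); rewrite swapL; apply: (absQ_fresh ab da).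
  by apply: contraNneq dl => ->; have /In_mem := List.in_map fst _ _ brl.
by apply: dfr; right; have := List.in_map snd _ _ brl.
Qed.

Lemma run_act p q w q' : finperm p -> run q w q' -> run (act p q) (bs_act p w) (act p q').
Proof.
move=> fp; elim=> {q w q'} [q|q q' w q'' /(trans_act fp) tr _|q l q' w q'' /(trans_act fp) tr _].
- exact: run_nil.
- exact: run_eps.
- exact: run_letter.
Qed.

Lemma run_cat q v q' w q'' : run q v q' -> run q' w q'' -> run q (v ++ w) q''.
Proof.
elim=> {q v q'} [//|q q1 v q' tr _ IH /IH|q l q1 v q' tr _ IH /IH].
- exact: run_eps.
- exact: run_letter.
Qed.

(** Silent moves are absorbed into the letter that follows, so that every edge of the finite
    automaton becomes a modality and guards the variables below it. *)
Definition step q l q' := exists2 q1, run q [::] q1 & trans q1 (Some l) q'.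

(** Joins both modes of acceptance: [u] is an arbitrary rest after a state of value [FTop], and
    empty after one of value [F1]. *)
Definition accepts q w := exists q' v u,
  [/\ w = v ++ u, run q v q' & f q' = FTop \/ (f q' = F1 /\ u = [::])].

Lemma run_eps_fresh q q' c : run q [::] q' -> fresh c q -> fresh c q'.
Proof.
move e: [::] => w r; elim: r e => {q w q'} // q q1 w q' tr _ IH e cq.
by apply: IH e (trans_eps_fresh tr cq).
Qed.

Lemma step_act p q l q' : finperm p -> step q l q' -> step (act p q) (bl_act p l) (act p q').
Proof.
by move=> fp [q1 /(run_act fp) r /(trans_act fp) tr]; exists (act p q1).
Qed.

Lemma step_bar_alpha q a q' b q'' : step q (Bar a) q' -> absQ a q' b q'' ->
  step q (Bar b) q''.
Proof. by move=> [q1 r tr] ab; exists q1 => //; apply: trans_bar_alpha tr ab. Qed.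

Lemma step_plain_fresh q a q' c : step q (Plain a) q' -> fresh c q -> c != a /\ fresh c q'.
Proof. by move=> [q1 r tr] /(run_eps_fresh r); apply: trans_plain_fresh. Qed.

Lemma step_bar_fresh q a q' c : step q (Bar a) q' -> fresh c q -> c != a -> fresh c q'.
Proof. by move=> [q1 r tr] /(run_eps_fresh r); apply: trans_bar_fresh. Qed.

Lemma accepts_step q l q' w : step q l q' -> accepts q' w -> accepts q (l :: w).
Proof.
move=> [q1 r tr] [q2 [v [u [-> r' fq]]]]; exists q2, (l :: v), u; split => //.
by apply: (@run_cat q [::] q1) => //; apply: run_letter tr r'.
Qed.

(** * The finite automaton on the states supported in [N] *)

Variables (N : seq nat) (l : list Q).
Hypothesis N_fresh : forall q : Q, exists2 a, a \in N & fresh a q.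
Hypothesis l_complete : forall q : Q, supported_in N q -> List.In q l.

(** The default [s] is harmless: edges lead only to indices below the length of [l]. *)
Definition state i := List.nth i l s.
Definition eps_final v i := `[< exists2 q, run (state i) [::] q & f q = v >].
Definition edges i : seq (bletter * nat) :=
  [seq e <- [seq (c, j) | c <- map Plain N ++ map Bar N, j <- iota 0 (length l)]
     | `[< step (state i) e.1 (state e.2) >]].

Local Notation node := (node (eps_final F1) (eps_final FTop) edges).
Local Notation build := (build (eps_final F1) (eps_final FTop) edges).
Local Notation rep := (rep N (eps_final F1) (eps_final FTop) edges).

Lemma edges_name i e : e \in edges i -> bl_name e.1 \in N.
Proof.
rewrite mem_filter => /andP[_ /allpairsP[[c j] [/= + _ ->]]].
by rewrite mem_cat => /orP[] /mapP[a aN ->].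
Qed.

Lemma edges_state i e : e \in edges i -> e.2 < length l.
Proof.
by rewrite mem_filter => /andP[_ /allpairsP[[c j] [/= _ + ->]]]; rewrite mem_iota.
Qed.

Lemma edges_step i e : e \in edges i -> step (state i) e.1 (state e.2).
Proof. by rewrite mem_filter => /andP[/asboolP]. Qed.

Lemma state_complete q : supported_in N q -> exists2 i, i < length l & state i = q.
Proof. by move=> /l_complete /(List.In_nth _ _ s)[i [/ltP ? ?]]; exists i. Qed.

Lemma edges_complete i c q : bl_name c \in N -> supported_in N q -> step (state i) c q ->
  exists j, (c, j) \in edges i /\ state j = q.
Proof.
move=> cN /state_complete[j jl <-] st; exists j; split => //.
rewrite mem_filter /=; apply/andP; split; first exact/asboolP.
apply/allpairsP; exists (c, j); rewrite mem_iota /=; split => //.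
by case: c cN {st} => a /= aN; rewrite mem_cat map_f ?orbT.
Qed.

(** Freshness passes along edges: a plain step neither reads a name fresh for its source nor makes
    it non-fresh, and a bar step can do so only for the name it binds, which is not free below the
    bar diamond. *)
Lemma build_fresh m env i a : fresh a (state i) -> a \notin f_fn (build m env i).
Proof.
elim: m env i => [|m IHm] env i afr; rewrite buildE; case: (lookup i env) => //=.
apply/negP => /disj_fn[|[[b|b] j] /edges_step /= st]; first exact: base_fn.
- have [ab aj] := step_plain_fresh st afr.
  by rewrite inE (negPf ab) (negPf (IHm _ _ aj)).
- rewrite mem_filter => /andP[ab].
  by rewrite (negPf (IHm _ _ (step_bar_fresh st afr ab))).
Qed.

(** Each letter costs one unfolding, and even the empty word needs one, hence the strict bound. The
    renaming [p] is general because a bar diamond changes it. *)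
Lemma sound k i psi p S w : size w < k -> finperm p -> rep k i psi ->
  sat S w (f_act p psi) ->
  exists2 w', alpha w' w & accepts (act p (state i)) w'.
Proof.
elim: k i psi p S w => // k IHk i psi p S w wk fp [_ _ [X [phi [g [-> unf gk]]]]] /= H.
have {H} : sat S w (f_act p (node i g)).
  by rewrite -unf f_act_subst; inversion H.
case/(sat_disj _ _ _ _ (base_act _ _ p i)) => [|[[[a|a] j] eE /= H]].
- rewrite /base; case: ifP => [/asboolP[q r fq] _|_].
    exists w; first exact: alpha_refl.
    exists (act p q), [::], w; split => //; first exact: (run_act fp r).
    by left; rewrite final_act.
  case: ifP => [/asboolP[q r fq] H|_ H].
    have -> : w = [::] by inversion H.
    exists [::]; first exact: alpha_refl.
    exists (act p q), [::], [::]; split => //; first exact: (run_act fp r).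
    by right; rewrite final_act.
  (* The state is not final, so [base] is falsity. *)
  by inversion H as [| |? ? ? ? H1 H2| | | | | | |]; inversion H1; subst; inversion H2.
- have [v wv Hv] : exists2 v, w = Plain (p a) :: v & sat S v (f_act p (g (Plain a, j))).
    by inversion H; exists v.
  rewrite wv in wk *; have [w' w'v acc] := IHk _ _ _ _ _ wk fp (gk _ eE) Hv.
  exists (Plain (p a) :: w'); first exact: alpha_cons.
  exact: accepts_step (step_act fp (edges_step eE)) acc.
- have [chi [v [b [wv ab Hv]]]] : exists chi v b, [/\ alpha w (Bar b :: v),
      abs_form (p a) (f_act p (g (Bar a, j))) b chi & sat (b :: S) v chi].
    by inversion H; exists psi0, v, b.
  (* A name [c] fresh for the word, both formulae and the target state lets the formula, the word
     and the transition all be renamed to the same binder. *)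
  have [c [+ /(_ (act p (state j)))cfr]] := ex_fresh_nom
    (bs_names v ++ f_names (f_act p (g (Bar a, j))) ++ f_names chi) [:: act p (state j)].
  rewrite !mem_cat !negb_or => /and3P[cv cg cchi].
  have := sat_act (finperm_swap b c) Hv.
  rewrite -(abs_form_fresh ab cg cchi) -f_act_comp => Hc.
  have fpc : finperm (swap (p a) c \o p) by apply: finperm_comp => //; apply: finperm_swap.
  have vk : size (bs_act (swap b c) v) < k.
    by rewrite size_map; move: wk; rewrite (alpha_size wv).
  have [w' w'v acc] := IHk _ _ _ _ _ vk fpc (gk _ eE) Hc.
  exists (Bar c :: w').
    apply: alpha_trans (alpha_cons _ w'v) _; apply: alpha_trans (alpha_sym wv).
    exact/alpha_sym/alpha_bar.
  apply: accepts_step acc; rewrite nom_act_comp //; last exact: finperm_swap.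
  apply: (step_bar_alpha (step_act fp (edges_step eE))); rewrite swapC.
  by apply: absQ_swap; right; apply: cfr; left.
Qed.

(** A label outside [N] is replaced by a name of [N] fresh for [q]; a label in [N] is kept. The
    clause on [b] records this for the side condition of the formula renaming in [complete]. *)
Lemma step_bar_supported q a q' : supported_in N q -> step q (Bar a) q' ->
  exists b, [/\ b \in N, a \in N -> b = a, supported_in N (act (swap b a) q') &
    step q (Bar b) (act (swap b a) q')].
Proof.
move=> qN st; have [aN|aN] := boolP (a \in N).
  exists a; rewrite swap_id nom_act_id; split => // c cN.
  by apply: (step_bar_fresh st (qN _ cN)); apply: contraNneq cN => ->.
have [b bN bq] := N_fresh q; have ba : b != a by apply: contraNneq aN => <-.
have bq' := step_bar_fresh st bq ba.
exists b; split => //.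
- move=> c cN; have [->|ca] := eqVneq c a; first exact: fresh_swap.
  have cb : c != b by apply: contraNneq cN => ->.
  rewrite -(swapD cb ca); apply: fresh_act; first exact: finperm_swap.
  exact: step_bar_fresh st (qN _ cN) ca.
- by apply: (step_bar_alpha st); apply: absQ_swap; right.
Qed.

Lemma sat_rep k i psi p S w : rep k.+1 i psi ->
  exists2 g, (forall e, e \in edges i -> rep k e.2 (g e)) &
    sat S w (f_act p (node i g)) -> sat S w (f_act p psi).
Proof.
move=> [_ _ [X [phi [g [-> unf gk]]]]]; exists g => // H.
by apply: sat_mu; rewrite -[FMu X _]/(f_act p (FMu X phi)) -f_act_subst unf.
Qed.

(** The run may be ahead of the formula: [psi] represents [state i], whose renaming by [p] reaches
    [q] silently. Silent transitions extend this lag, and a letter resets it. *)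
Lemma complete q w q' : run q w q' ->
  forall p i k psi S u, finperm p -> size (w ++ u) < k -> supported_in N (state i) ->
  rep k i psi -> run (act p (state i)) [::] q ->
  f q' = FTop \/ (f q' = F1 /\ u = [::]) -> sat S (w ++ u) (f_act p psi).
Proof.
elim=> {q w q'} [q|q q1 w q' tr _ IH|q c q1 w q' tr _ IH] p i [//|k] psi S u fp wk iN.
- move=> /(sat_rep p S u)[g _ H] r fq; apply: H.
  apply/(sat_disj _ _ _ _ (base_act _ _ p i)); left.
  have [r' [fr' pK rK]] := finperm_inv fp.
  have := run_act fr' r; rewrite actK //= => r0.
  rewrite /base; case: ifP => [_|/asboolPn notop].
    by case: u {wk fq} => [|c u]; [apply/sat_orl/sat_eps|apply/sat_orr/sat_neps].
  case: fq => [fq|[fq ->]].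
    by case: notop; exists (act r' q) => //; rewrite final_act.
  case: ifP => [_|/asboolPn[]]; first exact: sat_eps.
  by exists (act r' q) => //; rewrite final_act.
- move=> ik r fq; apply: (IH p i k.+1) => //.
  by apply: (@run_cat _ [::] q) => //; apply: (run_eps tr); apply: run_nil.
- move=> /(sat_rep p S ((c :: w) ++ u))[g gk H] r fq; apply: H.
  apply/(sat_disj _ _ _ _ (base_act _ _ p i)); right.
  have [r' [fr' pK rK]] := finperm_inv fp.
  have st : step (state i) (bl_act r' c) (act r' q1).
    by rewrite -(actK (state i) fp fr' pK); apply: step_act => //; exists q.
  have q1E : act p (act r' q1) = q1 by apply: actK.
  case: c wk {tr r} st => a /= wk st.
    have aN : r' a \in N.
      by apply: contraT => /iN /(step_plain_fresh st)[]; rewrite eqxx.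
    have q1N : supported_in N (act r' q1).
      by move=> d /iN /(step_plain_fresh st)[].
    have [j [eE je]] := @edges_complete i (Plain (r' a)) _ aN q1N st.
    exists (Plain (r' a), j) => //=; rewrite rK; apply: sat_dia.
    apply: (IH p j k) => //; rewrite ?je ?q1E //; [exact: (gk _ eE) | exact: run_nil].
  have [b [bN ba bq1N stb]] := step_bar_supported iN st.
  have [j [eE je]] := @edges_complete i (Bar b) _ bN bq1N stb.
  exists (Bar b, j) => //=.
  have fpb : finperm (swap a (p b) \o p) by apply: finperm_comp => //; apply: finperm_swap.
  apply: (sat_diabar (alpha_refl _) (abs_form_swap _)) => [|].
    rewrite f_names_act => /mapP[d dg ad]; rewrite ad.
    by rewrite ba // ?ad ?pK // (rep_names (gk _ eE)).
  rewrite -f_act_comp; apply: (IH _ j k) => //; rewrite ?je //; first exact: (gk _ eE).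
  have -> : swap a (p b) \o p = p \o swap b (r' a).
    by rewrite -{1}(rK a) swap_conj ?(swapC b) //; apply: finperm_inj.
  rewrite nom_act_comp //; last exact: finperm_swap.
  by rewrite act_swapK q1E; apply: run_nil.
Qed.

End Automaton.

Theorem theorem6p6 (Q : nominal_set)
    (trans : Q -> option bletter -> Q -> Prop) (s : Q) (f : Q -> fval) :
  is_ernna trans s f ->
  exists phi : form,
    bar_formula phi /\ f_fn phi = [::] /\
    same_quotient (sem phi) (L_0 trans s f).
Proof.
move=> A; have [orb [s_supp _]] := A.
have s_fresh a : fresh a s by exists [::].
have [k kP] := support_bound orb.
set N := iota 0 k.+1.
have N_fresh (q : Q) : exists2 a, a \in N & fresh a q.
  have [S [Sq Sk]] := kP q.
  have [/allP NS|/allPn[a aN aS]] := boolP (all (mem S) N); last by exists a => //; exists S.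
  have := leq_trans (uniq_leq_size (iota_uniq 0 k.+1) NS) Sk.
  by rewrite size_iota ltnn.
have [l lP] := supported_in_finite N orb.
have [i il si] : exists2 i, i < length l & state s l i = s.
  by apply: (@state_complete _ s N l lP) => a _.
pose phi := build (eps_final trans s f l F1) (eps_final trans s f l FTop)
  (edges trans s N l) (length l) [::] i.
have phi_rep m : rep N (eps_final trans s f l F1) (eps_final trans s f l FTop)
    (edges trans s N l) m i phi.
  apply: (@rep_build (length l) N _ _ _ _ _ m (length l) [::] [::] i) => //.
  - exact: edges_name.
  - exact: edges_state.
  - by rewrite addn0.
have iN : supported_in N (state s l i) by rewrite si => a _.
exists phi; split; [exact: build_wf | split].
  have : forall a, a \notin f_fn phi.
    by move=> a; apply: build_fresh; rewrite ?si.
  by case: (f_fn phi) => // a S /(_ a); rewrite mem_head.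
have closed_alpha w w' : alpha w w' -> in_closure [::] w -> in_closure [::] w'.
  by move=> ww' cw a; rewrite -(alpha_fn ww'); apply: cw.
move=> w; split=> -[w' [[w'0 H] w'w]].
  have [w'' w''w' acc] : exists2 w'', alpha w'' w' & accepts trans f s w''.
    have := @sound _ _ _ _ A N l (size w').+1 i phi id [::] w' (ltnSn _) finperm_id (phi_rep _).
    by rewrite f_act_id nom_act_id si => /(_ H).
  exists w''; split; last exact: alpha_trans w''w' w'w.
  split; first exact: closed_alpha (alpha_sym w''w') w'0.
  case: acc => q [v [u [-> r [fq|[fq ->]]]]].
    by right; exists v, u; split => //; exists q; split => //; split => //; right.
  by left; rewrite cats0; exists q; split => //; split => //; left.
exists w'; split => //; split => //.
have [q [v [u [-> r fq]]]] : accepts trans f s w'.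
  case: H => [[q [r [fq _]]]|[v [u [-> [q [r [fq _]]]]]]].
    by exists q, w', [::]; rewrite cats0; split => //; right.
  by exists q, v, u; split => //; left.
rewrite -[phi]f_act_id.
apply: (@complete _ _ _ _ A N l N_fresh lP _ _ _ r id i (size (v ++ u)).+1) => //.
  exact: finperm_id.
by rewrite nom_act_id si; apply: run_nil.
Qed.
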